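(* Let $A$ be a symmetric composition algebra over a field $F$ of characteristic not $2$. Let $a=(a_1,a_2,a_3)\in\Sigma$, i.e. $a_1,a_2,a_3\in A$ with $a_ja_{j+1}=a_{j+2}$ and $\langle a_j|a_j\rangle=1$ for all $j=1,2,3$ (indices modulo $3$). Set $$\sigma_j(a)=R(a_{j+1})R(a_{j+2}),\qquad \theta_j(a)=L(a_{j+2})L(a_{j+1})\qquad (j=1,2,3).$$ Then for all $j=1,2,3$ (indices modulo $3$) and all $x,y\in A$: (i) $\sigma_j(a)(xy)=(\sigma_{j+1}(a)x)(\sigma_{j+2}(a)y)$; (ii) $\theta_j(a)(xy)=(\theta_{j+1}(a)x)(\theta_{j+2}(a)y)$; (iii) $\sigma_j(a)\theta_j(a)=\theta_j(a)\sigma_j(a)=\mathrm{Id}$; (iv) $\theta_j(a)\theta_{j+1}(a)\theta_{j+2}(a)=\sigma_{j+2}(a)\sigma_{j+1}(a)\sigma_j(a)=\mathrm{Id}$; (v) $\langle\sigma_j(a)x|y\rangle=\langle x|\theta_j(a)y\rangle$; (vi) $\langle\sigma_j(a)x|\sigma_j(a)y\rangle=\langle\theta_j(a)x|\theta_j(a)y\rangle=\langle x|y\rangle$. Especially, both triples $\sigma(a)=(\sigma_1(a),\sigma_2(a),\sigma_3(a))$ and $\theta(a)=(\theta_1(a),\theta_2(a),\theta_3(a))$ are elements of $\mathrm{Trig}(A)$.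
   Context: A symmetric composition algebra over a field $F$ of characteristic not $2$ is an $F$-algebra $A$ (bilinear product $xy$, not assumed associative or unital) with a non-degenerate symmetric bilinear form $\langle\cdot|\cdot\rangle$ such that $(xy)x=x(yx)=\langle x|x\rangle y$ for all $x,y\in A$; such an algebra also satisfies $\langle xy|xy\rangle=\langle x|x\rangle\langle y|y\rangle$ and $\langle xy|z\rangle=\langle x|yz\rangle$. The multiplication operators are $L(x)y=xy$ and $R(x)y=yx$. The triality group $\mathrm{Trig}(A)$ is the set of triples $(g_1,g_2,g_3)$ of surjective linear endomorphisms of $A$ with $g_j(xy)=(g_{j+1}x)(g_{j+2}y)$ for all $x,y\in A$ and all $j=1,2,3$ (indices modulo $3$), with componentwise composition. All indices $j$ are taken modulo $3$. *)

(* Defs.v *)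
From HB Require Import structures.
From mathcomp Require Import all_boot all_order all_algebra.

Set Implicit Arguments.
Unset Strict Implicit.
Unset Printing Implicit Defensive.

Import GRing.Theory.
Local Open Scope ring_scope.

Section SymmetricComposition.
Variables (F : fieldType) (A : lmodType F).
Variables (mul : {bilinear A -> A -> A}) (form : {symmetric A}).

(* sesquilinear.nondegenerate needs a finite-dimensional carrier (vectType);
   A may have any dimension here. The form is symmetric, so the left radical
   is the whole radical. *)
Definition nondegenerate_form : Prop :=
  forall x : A, (forall y : A, form x y = 0) -> x = 0.

Definition symmetric_composition : Prop :=
  [/\ nondegenerate_form,
      forall x y : A, mul (mul x y) x = form x x *: y
    & forall x y : A, mul x (mul y x) = form x x *: y].

Definition Lop (x : A) : A -> A := fun y => mul x y.
Definition Rop (x : A) : A -> A := fun y => mul y x.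

(* Triples indexed by 1, 2, 3 modulo 3 are functions on 'Z_3, so that the third
   component is the one at 0 = 3 and j + 1, j + 2 are taken modulo 3. *)
Definition in_Sigma (a : 'Z_3 -> A) : Prop :=
  forall j : 'Z_3, mul (a j) (a (j + 1)) = a (j + 2) /\ form (a j) (a j) = 1.

Definition sigma (a : 'Z_3 -> A) (j : 'Z_3) : A -> A :=
  Rop (a (j + 1)) \o Rop (a (j + 2)).

Definition theta (a : 'Z_3 -> A) (j : 'Z_3) : A -> A :=
  Lop (a (j + 2)) \o Lop (a (j + 1)).

Definition in_Trig (g : 'Z_3 -> A -> A) : Prop :=
  forall j : 'Z_3,
    [/\ linear (g j),
        forall y : A, exists x : A, g j x = y
      & forall x y : A, g j (mul x y) = mul (g (j + 1) x) (g (j + 2) y)].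

End SymmetricComposition.

(* Main.v *)
Require Import Defs.
From HB Require Import structures.
From mathcomp Require Import all_boot all_order all_algebra.

Set Implicit Arguments.
Unset Strict Implicit.
Unset Printing Implicit Defensive.

Import GRing.Theory.
Local Open Scope ring_scope.

(* Linearizing the flexible identities gives the exchange rules
   (xy)z + (zy)x = 2<x|z>y = x(yz) + z(yx), from which the associativity of the
   form follows.  Unit vectors satisfy L(a) = R(a)^-1, so sigma_j and theta_j are
   mutually inverse and adjoint; multiplicativity of sigma_j is obtained by
   expanding both sides with the exchange rules, and that of theta_j by inversion.
   Finally the product of the three theta's is the square of L(c)L(b)L(a), which
   is the involution x |-> 2<b|x>b - x. *)

(** Polarization: [n], [m] are the diagonal terms and [p], [q] the mixed terms of a quadratic
    expression expanded at a sum. *)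
Lemma polar_eq (V : zmodType) (n m t p q : V) :
  (n + p) + (q + m) = n + m + t -> p = t - q.
Proof. by rewrite (addrC q) addrACA => /addrI <-; rewrite addrK. Qed.

(* The cancellation left over after expanding mul_sigma with the exchange rules. *)
Lemma subr_alternate (V : zmodType) (u v w p s : V) :
  u - (u - p) - (v - (w - (p - (v - s)))) = w - s.
Proof.
rewrite subKr !opprB -(addrA v) [_ - v]addrAC (addrA (w - v)) subrK.
by rewrite (addrCA p w) (addrCA p (- s)) subrr addr0.
Qed.

Lemma Z3_add11 (j : 'Z_3) : j + 1 + 1 = j + 2.
Proof. by rewrite -addrA. Qed.

Lemma Z3_add12 (j : 'Z_3) : j + 1 + 2 = j.
Proof. by rewrite -addrA (_ : 1 + 2 = 0) ?addr0 //; apply/val_inj. Qed.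

Lemma Z3_add21 (j : 'Z_3) : j + 2 + 1 = j.
Proof. by rewrite addrAC Z3_add12. Qed.

Lemma Z3_add22 (j : 'Z_3) : j + 2 + 2 = j + 1.
Proof. by rewrite -(Z3_add11 j) Z3_add12. Qed.

Definition Z3_addE := (Z3_add11, Z3_add12, Z3_add21, Z3_add22).

Section SymmetricCompositionTheory.
Variables (F : fieldType) (A : lmodType F).
Variables (mul : {bilinear A -> A -> A}) (form : {symmetric A}).
Hypothesis hA : symmetric_composition mul form.

Local Notation "x ** y" := (mul x y) (at level 40, left associativity).
Local Notation "<| x , y |>" := (form x y).

Lemma symm_formC x y : <|x, y|> = <|y, x|>.
(* [{symmetric A}] is hermitian with sign exponent 0, which leaves a factor $(-1)^0$. *)
Proof. by rewrite hermC expr0 mul1r. Qed.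

Lemma symm_formD x z : <|x + z, x + z|> = <|x, x|> + <|z, z|> + <|x, z|> *+ 2.
Proof. by rewrite hnormD expr0 mul1r mulr2n. Qed.

Lemma mul_flexl x y : x ** y ** x = <|x, x|> *: y.
Proof. by case: hA. Qed.

Lemma mul_flexr x y : x ** (y ** x) = <|x, x|> *: y.
Proof. by case: hA. Qed.

Lemma mul_flipl x y z : x ** y ** z = (<|x, z|> *+ 2) *: y - z ** y ** x.
Proof.
apply: (@polar_eq _ (x ** y ** x) (z ** y ** z)).
by rewrite !mul_flexl -!scalerDl -symm_formD -!mul_flexl !linearDl !linearDr.
Qed.

Lemma mul_flipr x y z : x ** (y ** z) = (<|x, z|> *+ 2) *: y - z ** (y ** x).
Proof.
apply: (@polar_eq _ (x ** (y ** x)) (z ** (y ** z))).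
by rewrite !mul_flexr -!scalerDl -symm_formD -!mul_flexr !linearDl !linearDr.
Qed.

Lemma form_assoc (char_neq2 : 2%N \notin [pchar F]) x y z :
  <|x ** y, z|> = <|x, y ** z|>.
Proof.
(* Two multiples of [y] get compared below; their coefficients agree only once [y] is nonzero. *)
have [->|y_neq0] := eqVneq y 0.
  by rewrite linear0r linear0l linear0r linear0l.
have two_neq0 : 2%:R != 0 :> F by apply: contraNneq char_neq2 => /eqP.
(* (xy)(yz) + <y|y>zx is both 2<xy|z>y and 2<x|yz>y. *)
have L : (<|x ** y, z|> *+ 2) *: y = (x ** y) ** (y ** z) + <|y, y|> *: (z ** x).
  by rewrite mul_flipr mul_flexr linearZr_LR subrK.
have R : (<|x, y ** z|> *+ 2) *: y = (x ** y) ** (y ** z) + <|y, y|> *: (z ** x).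
  by rewrite mul_flipl mul_flexl linearZl_LR subrK.
have /eqP := etrans L (esym R).
rewrite -subr_eq0 -scalerBl scaler_eq0 (negbTE y_neq0) orbF -mulrnBl.
by rewrite -mulr_natr mulf_eq0 (negbTE two_neq0) orbF subr_eq0 => /eqP.
Qed.

Lemma unit_LRK u x : <|u, u|> = 1 -> u ** (x ** u) = x.
Proof. by move=> Nu; rewrite mul_flexr Nu scale1r. Qed.

Lemma unit_RLK u x : <|u, u|> = 1 -> u ** x ** u = x.
Proof. by move=> Nu; rewrite mul_flexl Nu scale1r. Qed.

Section Triple.
Hypothesis char_neq2 : 2%N \notin [pchar F].
Variables a b c : A.
Hypotheses (Eab : a ** b = c) (Ebc : b ** c = a) (Eca : c ** a = b).
Hypotheses (Nb : <|b, b|> = 1) (Nc : <|c, c|> = 1).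

(** With $(a,b,c)=(a_j,a_{j+1},a_{j+2})$ this is (i). The exchange rules bring the left side to
    $2\langle xy|b\rangle c-a(xy)$ and the right side to $2\langle bx|y\rangle c-a(xy)$. *)
Lemma mul_sigma x y : x ** y ** c ** b = (x ** a ** c) ** (y ** b ** a).
Proof.
(* Modulo a multiple of one fixed vector, two right multiplications become minus a left
   multiplication by the third element. *)
rewrite (mul_flipl (x ** y) c b) Ebc (mul_flipl x a c) Eca (mul_flipl y b a) Eab.
rewrite linearBl linearZl_LR /= (linearBr _ (b ** x)) linearZr_LR /=.
rewrite (unit_RLK _ Nb) (linearBr _ a) linearZr_LR /= Eab.
rewrite (mul_flipr a c y) (mul_flipr (b ** x) c y) (mul_flipr c b x) Ebc.
rewrite Eca (linearBr _ y) linearZr_LR /= (mul_flipr y x a).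
rewrite (symm_formC a y) (symm_formC c x) !scalerBr subr_alternate.
by rewrite (symm_formC (x ** y)) form_assoc.
Qed.

(** Exchanging [b] and [x] gives $b(ax)=2\langle b|x\rangle a-xc$; then $L(c)$ sends [a] to [b] and
    undoes $R(c)$. *)
Lemma mulLLL x : c ** (b ** (a ** x)) = (<|b, x|> *+ 2) *: b - x.
Proof. by rewrite (mul_flipr b) Eab linearBr linearZr_LR /= Eca unit_LRK. Qed.

(** Grouped in pairs, the six factors are $\theta_j$, $\theta_{j+1}$, $\theta_{j+2}$. *)
Lemma mulLLLK x : c ** (b ** (a ** (c ** (b ** (a ** x))))) = x.
Proof.
(* As $\langle b|b\rangle=1$, the vector $2\langle b|x\rangle b-x$ has the same product with [b] as
   [x]. *)
rewrite (mulLLL x) mulLLL linearBr linearZr_LR /= Nb mulr1 mulrnBl.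
by rewrite mulr2n addrK subKr.
Qed.

End Triple.
End SymmetricCompositionTheory.

Theorem theorem2p5 (F : fieldType) (char_neq2 : 2%N \notin [pchar F])
    (A : lmodType F) (mul : {bilinear A -> A -> A}) (form : {symmetric A})
    (hA : symmetric_composition mul form)
    (a : 'Z_3 -> A) (ha : in_Sigma mul form a) :
  (forall (j : 'Z_3) (x y : A),
     sigma mul a j (mul x y)
       = mul (sigma mul a (j + 1) x) (sigma mul a (j + 2) y)) /\
  (forall (j : 'Z_3) (x y : A),
     theta mul a j (mul x y)
       = mul (theta mul a (j + 1) x) (theta mul a (j + 2) y)) /\
  (forall j : 'Z_3,
     sigma mul a j \o theta mul a j =1 id /\
     theta mul a j \o sigma mul a j =1 id) /\
  (forall j : 'Z_3,
     theta mul a j \o theta mul a (j + 1) \o theta mul a (j + 2) =1 id /\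
     sigma mul a (j + 2) \o sigma mul a (j + 1) \o sigma mul a j =1 id) /\
  (forall (j : 'Z_3) (x y : A),
     form (sigma mul a j x) y = form x (theta mul a j y)) /\
  (forall (j : 'Z_3) (x y : A),
     form (sigma mul a j x) (sigma mul a j y) = form x y /\
     form (theta mul a j x) (theta mul a j y) = form x y) /\
  in_Trig mul (sigma mul a) /\
  in_Trig mul (theta mul a).
Proof.
have Emul j : mul (a j) (a (j + 1)) = a (j + 2) by case: (ha j).
have Emul1 j : mul (a (j + 1)) (a (j + 2)) = a j.
  by have := Emul (j + 1); rewrite !Z3_addE.
have Emul2 j : mul (a (j + 2)) (a j) = a (j + 1).
  by have := Emul (j + 2); rewrite !Z3_addE.
have N j : form (a j) (a j) = 1 by case: (ha j).
have S j x y : sigma mul a j (mul x y)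
    = mul (sigma mul a (j + 1) x) (sigma mul a (j + 2) y).
  rewrite /sigma /= /Rop !Z3_addE.
  exact: (mul_sigma hA char_neq2 (Emul j) (Emul1 j) (Emul2 j)).
have ST j : cancel (theta mul a j) (sigma mul a j).
  by move=> x; rewrite /sigma /theta /= /Rop /Lop !(unit_RLK hA).
have TS j : cancel (sigma mul a j) (theta mul a j).
  by move=> x; rewrite /sigma /theta /= /Rop /Lop !(unit_LRK hA).
have T j x y : theta mul a j (mul x y)
    = mul (theta mul a (j + 1) x) (theta mul a (j + 2) y).
  (* Compare the images under the injective $\sigma_j$. *)
  by apply: (can_inj (TS j)); rewrite S !ST.
have T3 j x : theta mul a j (theta mul a (j + 1) (theta mul a (j + 2) x)) = x.
  rewrite /theta /= /Lop !Z3_addE.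
  exact: (mulLLLK hA (Emul j) (Emul2 j)).
have adj j x y : form (sigma mul a j x) y = form x (theta mul a j y).
  by rewrite /sigma /theta /= /Rop /Lop !(form_assoc hA).
have linS j : linear (sigma mul a j).
  by move=> k x y; rewrite /sigma /= /Rop !linearPl.
have linT j : linear (theta mul a j).
  by move=> k x y; rewrite /theta /= /Lop !linearPr.
split; first exact: S.
split; first exact: T.
split; first by move=> j; split=> x; [exact: ST | exact: TS].
split.
  move=> j; split=> x /=; first exact: T3.
  (* With [x] written as $\theta_j\theta_{j+1}\theta_{j+2}x$, the three $\sigma$'s cancel from the
     inside out. *)
  by rewrite -[in LHS](T3 j x) !ST.
split; first exact: adj.
split; first by move=> j x y; split; [rewrite adj TS | rewrite -adj ST].
split=> j; split=> //.
- by move=> y; exists (theta mul a j y); exact: ST.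
- by move=> y; exists (sigma mul a j y); exact: TS.
Qed.
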